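(* Let $(E^\lambda)$ be a sequence of measurable subsets of $\mathbb R^2$, indexed by parameters $\lambda\to\infty$, with $|E^\lambda|=\pi$ for all $\lambda$. (1) If $$\limsup_{\lambda\to\infty}\frac{\mathcal F^\lambda_C(E^\lambda)}{\lambda\log\lambda}\le0,$$ then $$\limsup_{\lambda\to\infty}\frac{\log(\operatorname{diam}(E^\lambda))}{\log\lambda}\le1.$$ (2) If $$\limsup_{\lambda\to\infty}\frac{\mathcal F^\lambda_C(E^\lambda)}{\lambda\log\lambda}=-\pi^2,$$ then $$\lim_{\lambda\to\infty}\frac{\log(\operatorname{diam}(E^\lambda))}{\log\lambda}=1.$$
   Context: $|E|$ denotes Lebesgue measure on $\mathbb R^2$ and $P$ the usual (De Giorgi) perimeter. For measurable $E\subset\mathbb R^2$ the connected perimeter is $$\overline{P^r_C}(E)=\inf\{\liminf_{n\to\infty}P(E_n)\mid E_n\to E\text{ in }L^1,\ E_n\text{ connected and }C^\infty\text{-smooth}\},$$ where $E_n\to E$ in $L^1$ means $\chi_{E_n}\to\chi_E$ in $L^1(\mathbb R^2)$. For $\lambda>0$, $$\mathcal F^\lambda_C(E)=\overline{P^r_C}(E)+\lambda\int_E\int_E\log\left(\frac1{|x-y|}\right)\,\mathrm dx\,\mathrm dy,$$ understood to be $+\infty$ when $\overline{P^r_C}(E)=+\infty$. The diameter of a measurable set is the essential diameter $$\operatorname{diam}(E)=\sup\{|x-y|\ :\ |E\cap B_r(x)|>0\text{ and }|E\cap B_r(y)|>0\ \ \forall r>0\},$$ where $B_r(x)$ is the ball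 of radius $r$ around $x$ in $\mathbb R^2$. *)

(* Defs.v *)
From HB Require Import structures.
From mathcomp Require Import all_boot all_order all_algebra.
From mathcomp Require Import all_classical all_reals all_analysis.

Set Implicit Arguments.
Unset Strict Implicit.
Unset Printing Implicit Defensive.
Import Order.TTheory GRing.Theory Num.Theory.
Import numFieldNormedType.Exports.

Local Open Scope classical_set_scope.
Local Open Scope ring_scope.
Local Open Scope ereal_scope.

(* The library norm on [R * R] is the sup norm, so it only provides the
   topology (and differentiability); lengths are measured with [dist2]. *)
Definition dist2 (R : realType) (x y : R * R) : R :=
  Num.sqrt ((x.1 - y.1) ^+ 2 + (x.2 - y.2) ^+ 2)%R.

Definition disk (R : realType) (x : R * R) (r : R) : set (R * R) :=
  [set y | (dist2 x y < r)%R].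

Definition borel_lebesgue2 (R : realType) :
    set (measurableTypeR R * measurableTypeR R) -> \bar R :=
  @lebesgue_measure R \x @lebesgue_measure R.

HB.instance Definition _ (R : realType) := Measure.on (@borel_lebesgue2 R).

(* [lplane R] is a copy of [R * R] whose measurable sets are all the Lebesgue
   measurable ones (not only the Borel ones), by Caratheodory completion. *)
Definition lplane (R : realType) :=
  caratheodory_type ((@borel_lebesgue2 R)^*)%mu.

HB.instance Definition _ (R : realType) := Measurable.on (lplane R).

Definition leb2 (R : realType) : set (lplane R) -> \bar R :=
  @completed_measure_extension _ _ _ (@borel_lebesgue2 R).

HB.instance Definition _ (R : realType) := Measure.on (@leb2 R).

Definition dx1 (R : realType) (f : R * R -> R) : R * R -> R :=
  fun x => 'D_((1, 0)%R : R * R) f x.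
Definition dx2 (R : realType) (f : R * R -> R) : R * R -> R :=
  fun x => 'D_((0, 1)%R : R * R) f x.

Fixpoint Ck (R : realType) (k : nat) (f : R * R -> R) : Prop :=
  continuous f /\
  if k is k'.+1 then
    [/\ forall x, derivable f x ((1, 0)%R : R * R),
        forall x, derivable f x ((0, 1)%R : R * R),
        Ck k' (dx1 f) & Ck k' (dx2 f)]
  else True.

Definition smooth_fun (R : realType) (f : R * R -> R) : Prop :=
  forall k, Ck k f.

Definition C1c (R : realType) (f : R * R -> R) : Prop :=
  Ck 1 f /\ compact (closure [set x | f x != 0%R]).

(* De Giorgi perimeter: supremum of the integrals over [E] of [div (f, g)],
   over the fields [(f, g)] in C^1_c(R^2; R^2) with Euclidean norm <= 1. *)
Definition perimeter (R : realType) (E : set (lplane R)) : \bar R :=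
  ereal_sup [set z : \bar R | exists f g : R * R -> R,
    [/\ C1c f, C1c g, forall x, (f x ^+ 2 + g x ^+ 2 <= 1)%R &
        z = \int[@leb2 R]_(x in E) (dx1 f x + dx2 g x)%:E]].

(* Open set lying locally on one side of its boundary, the latter being a
   regular level set of a smooth function. *)
Definition smooth_set (R : realType) (E : set (R * R)) : Prop :=
  open E /\
  forall x, (closure E `\` interior E) x ->
    exists r : R, exists psi : R * R -> R,
    [/\ (0 < r)%R, smooth_fun psi,
        forall y, disk x r y -> ~ (dx1 psi y = 0%R /\ dx2 psi y = 0%R),
        E `&` disk x r = [set y | (psi y < 0)%R] `&` disk x r &
        (closure E `\` interior E) `&` disk x r =
          [set y | psi y = 0%R] `&` disk x r].

Definition cvg_L1 (R : realType) (A : nat -> set (lplane R))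
    (E : set (lplane R)) : Prop :=
  \int[@leb2 R]_x `|\1_(A n) x - \1_E x|%:E @[n --> \oo] --> 0.

Definition connected_perimeter (R : realType) (E : set (lplane R)) : \bar R :=
  ereal_inf [set z : \bar R | exists A : nat -> set (R * R),
    [/\ forall n, connected (A n), forall n, smooth_set (A n),
        cvg_L1 A E & z = limn_einf (fun n => perimeter (A n))]].

Definition log_energy (R : realType) (E : set (lplane R)) : \bar R :=
  \int[@leb2 R]_(x in E) \int[@leb2 R]_(y in E) (ln (dist2 x y)^-1)%:E.

(* The case split is needed because [+oo + -oo = -oo] in the library. *)
Definition functionalF (R : realType) (lambda : R) (E : set (lplane R))
    : \bar R :=
  if connected_perimeter E == +oo then +oo
  else connected_perimeter E + lambda%:E * log_energy E.

Definition ess_diam (R : realType) (E : set (lplane R)) : \bar R :=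
  ereal_sup [set z : \bar R | exists x y : R * R,
    [/\ forall r : R, (0 < r)%R -> 0 < @leb2 R (E `&` disk x r),
        forall r : R, (0 < r)%R -> 0 < @leb2 R (E `&` disk y r) &
        z = (dist2 x y)%:E]].

(* Main.v *)
(* If [D] is the essential diameter of [E], then both terms of the functional
   are controlled by [D]: the connected perimeter is at least [D / 8], and the
   energy is at least [- |E|^2 log^+ D] because almost all pairs of points of
   [E] are at distance at most [D].  Hence
     F^lambda(E) >= D / 8 - lambda pi^2 log^+ D.
   If [log D > (1 + d) log lambda], the linear term dominates and
   [F^lambda(E) / (lambda log lambda)] is unbounded; dropping the linear term
   gives [log D / log lambda >= - F^lambda(E) / (pi^2 lambda log lambda)].

   For the perimeter bound let [A] be open and connected with finite area, and
   let its projection to an axis contain an interval.  Over a short piece of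
   that interval, [A] contains a rectangle; take a field pointing across the
   axis that rises from 0 to 1 inside the rectangle and then descends very
   slowly, so that the descent costs little because [|A|] is finite.  Fields
   over adjacent pieces add up, so the perimeter of [A] is at least a multiple
   of the length of the interval, and this bound passes to the L^1 limit. *)
Require Import Defs.
From HB Require Import structures.
From mathcomp Require Import all_boot all_order all_algebra.
From mathcomp Require Import all_classical all_reals all_analysis.
From mathcomp Require Import measurable_realfun ring lra.
Set Implicit Arguments.
Unset Strict Implicit.
Unset Printing Implicit Defensive.
Import Order.TTheory GRing.Theory Num.Theory.
Import numFieldNormedType.Exports.

Local Open Scope classical_set_scope.
Local Open Scope ring_scope.

(** * Lebesgue measurability in the plane, and comparison of [dist2] with the coordinates *)

Section plane_measure.
Context {R : realType}.
Implicit Types (A E : set (R * R)) (x y : R * R) (e r : R).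

Lemma rectangle_measurable (I J : set R) : measurable I -> measurable J ->
  measurable (I `*` J : set (lplane R)).
Proof.
move=> mI mJ; apply: caratheodory_measurable_mu_ext.
exact: measurableX.
Qed.

Lemma leb2_rectangle (I J : set R) : measurable I -> measurable J ->
  @leb2 R (I `*` J) = (lebesgue_measure I * lebesgue_measure J)%E.
Proof.
move=> mI mJ; rewrite /leb2 /completed_measure_extension /= measurable_mu_extE.
  exact: product_measure1E.
exact: measurableX.
Qed.

Definition square x e : set (R * R) :=
  [set y | (`|y.1 - x.1| < e) /\ (`|y.2 - x.2| < e)].

Definition rational_square (p : rat * rat * rat) : set (R * R) :=
  square (ratr p.1.1, ratr p.1.2) (ratr p.2).

Lemma squareE x e :
  square x e = `]x.1 - e, x.1 + e[%classic `*` `]x.2 - e, x.2 + e[%classic.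
Proof.
by apply/seteqP; split => y /=; rewrite !in_itv/= -!ltr_distl => -[].
Qed.

Lemma square_measurable x e : measurable (square x e : set (lplane R)).
Proof.
by rewrite squareE; apply: rectangle_measurable; exact: measurable_itv.
Qed.

Lemma rational_square_approx x e : 0 < e ->
  exists p, rational_square p x /\ rational_square p `<=` square x e.
Proof.
move=> e0.
have [|c] := @rat_in_itvoo R 0 (e / 2); first by rewrite divr_gt0.
rewrite in_itv /= => /andP[c0 ce].
have dense (t : R) : exists q : rat, (`|t - ratr q| < ratr c).
  have [|q] := @rat_in_itvoo R (t - ratr c) (t + ratr c); first by lra.
  by rewrite in_itv /= -ltr_distlC => ?; exists q.
have [q1 h1] := dense x.1; have [q2 h2] := dense x.2.
exists (q1, q2, c); split => // y [/= k1 k2].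
split.
  rewrite (_ : y.1 - x.1 = (y.1 - ratr q1) - (x.1 - ratr q1)); last by ring.
  by apply: (le_lt_trans (ler_normB _ _)); lra.
rewrite (_ : y.2 - x.2 = (y.2 - ratr q2) - (x.2 - ratr q2)); last by ring.
by apply: (le_lt_trans (ler_normB _ _)); lra.
Qed.

Lemma open_square A x : open A -> A x ->
  exists2 e : R, (0 < e) & square x e `<=` A.
Proof.
move=> oA Ax; have := open_nbhs_nbhs (conj oA Ax).
rewrite -nbhs_ballE => -[e /= e0 he]; exists e => // y [y1 y2].
by apply: he; split => /=; rewrite -ball_normE /= distrC.
Qed.

(** The rational squares contained in [A] cover it, and there are only countably many of them. *)
Lemma open_lplane_measurable A : open A -> measurable (A : set (lplane R)).
Proof.
move=> oA.
have -> : A =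
    \bigcup_(p in [set p | rational_square p `<=` A]) rational_square p.
  apply/seteqP; split => [x Ax|x [p /= pA]]; last exact: pA.
  have [e e0 eA] := open_square oA Ax.
  have [p [px pe]] := rational_square_approx x e0.
  by exists p => //=; exact: subset_trans pe eA.
rewrite bigcup_mkcond; apply: (@countable_bigcupT_measurable _ (lplane R)).
  exact: countableP.
move=> p; case: ifPn => _; [exact: square_measurable|exact: measurable0].
Qed.

Lemma continuous_lplane_measurable (D : set (lplane R)) (f : R * R -> R) :
  measurable D -> continuous f -> measurable_fun D (f : lplane R -> R).
Proof.
move=> mD cf; apply: (measurability _ (RGenOInfty.measurableE R)).
move=> /= _ [_ [a ->]] <-; apply: measurableI => //.
by apply: open_lplane_measurable; apply: open_comp => // x _; exact: cf.
Qed.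

Lemma dist2_ge0 x y : 0 <= dist2 x y. Proof. exact: sqrtr_ge0. Qed.

Lemma dist2_coord x y :
  (`|x.1 - y.1| <= dist2 x y) /\ (`|x.2 - y.2| <= dist2 x y).
Proof.
rewrite /dist2 -!sqrtr_sqr; split; apply: ler_wsqrtr.
  by rewrite lerDl sqr_ge0.
by rewrite lerDr sqr_ge0.
Qed.

Lemma dist2_le_coord x y : dist2 x y <= `|x.1 - y.1| + `|x.2 - y.2|.
Proof.
rewrite /dist2 -[leRHS]ger0_norm ?addr_ge0// -sqrtr_sqr; apply: ler_wsqrtr.
rewrite -(@real_normK _ (x.1 - y.1)) ?num_real//.
rewrite -(@real_normK _ (x.2 - y.2)) ?num_real//.
have := normr_ge0 (x.1 - y.1); have := normr_ge0 (x.2 - y.2); nra.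
Qed.

Lemma square_sub_disk x r : square x (r / 2) `<=` disk x r.
Proof.
move=> y [y1 y2]; rewrite /disk /=; apply: (le_lt_trans (dist2_le_coord _ _)).
rewrite distrC [X in (_ + X)]distrC; lra.
Qed.

Lemma continuous_dist2 x : continuous (dist2 x).
Proof.
move=> y; rewrite /dist2.
apply: (@continuous_comp _ _ _
  (fun z : R * R => (x.1 - z.1) ^+ 2 + (x.2 - z.2) ^+ 2) Num.sqrt);
  last exact: sqrt_continuous.
have c1 : {for y, continuous (fun z : R * R => x.1 - z.1)}.
  by apply: cvgB; [exact: cvg_cst|exact: cvg_fst].
have c2 : {for y, continuous (fun z : R * R => x.2 - z.2)}.
  by apply: cvgB; [exact: cvg_cst|exact: cvg_snd].
by apply: cvgD; rewrite expr2; under eq_fun do rewrite expr2; exact: cvgM.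
Qed.

Lemma disk_measurable x r : measurable (disk x r : set (lplane R)).
Proof.
apply: open_lplane_measurable.
rewrite (_ : disk x r = dist2 x @^-1` [set t | (t < r)]) //.
by apply: open_comp; [move=> y _; exact: continuous_dist2|exact: open_lt].
Qed.

End plane_measure.

(** * One-variable C^1 cut-off functions *)

Section profile.
Context {R : realType}.
Implicit Types (s t u v w z L : R).

Definition sqpos z : R := Num.max z 0 ^+ 2.

(** A quadratic remainder that is uniform across the kink at 0 yields the derivative at every point
    at once. *)
Lemma sqpos_taylor z s :
  `|sqpos (s + z) - sqpos z - s * (2 * Num.max z 0)| <= s ^+ 2.
Proof.
rewrite /sqpos /Num.max.
case: (ltrP z 0) => z0; case: (ltrP (s + z) 0) => sz0;
  rewrite ler_norml; apply/andP; split; nra.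
Qed.

Lemma is_derive_sqpos z : is_derive z (1 : R) sqpos (2 * Num.max z 0).
Proof.
have H : h^-1 *: ((sqpos \o shift z) (h *: (1 : R)) - sqpos z)
    @[h --> (0 : R)^'] --> 2 * Num.max z 0.
  apply/cvgrPdist_le => e e0.
  near=> h.
  have h0 : h != 0 by near: h; exact: nbhs_dnbhs_neq.
  have he : `|h| <= e by near: h; apply: dnbhs0_le.
  rewrite /= distrC /GRing.scale /= mulr1.
  have -> : (h^-1 * (sqpos (h + z) - sqpos z) - 2 * Num.max z 0 =
      h^-1 * (sqpos (h + z) - sqpos z - h * (2 * Num.max z 0))) by field.
  rewrite normrM normfV ler_pdivrMl ?normr_gt0//.
  apply: (le_trans (sqpos_taylor z h)).
  by rewrite -[leLHS]ger0_norm ?sqr_ge0// normrX expr2 ler_wpM2l.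
apply: DeriveDef; first by apply/cvg_ex; eexists; exact: H.
exact: cvg_lim H.
Unshelve. all: by end_near. Qed.

(* A C^1 step from 0 (on [z <= 0]) to 1 (on [z >= 1]). *)
Definition step z : R :=
  2 * sqpos z - 4 * sqpos (z - 2^-1) + 2 * sqpos (z - 1).

(** The tent on [0, 1] with peak 2 at 1/2; it is the derivative of [step]. *)
Definition hat z : R :=
  4 * Num.max z 0 - 8 * Num.max (z - 2^-1) 0 + 4 * Num.max (z - 1) 0.

Lemma is_derive_step z : is_derive z (1 : R) step (hat z).
Proof.
have sq c : is_derive z (1 : R) (fun y => sqpos (y - c))
    (2 * Num.max (z - c) 0).
  have := @is_derive1_comp R sqpos (fun y => y - c) z _ _
    (is_derive_sqpos (z - c)) _.
  by move=> /(_ 1); rewrite mulr1; apply; apply: is_derive_eq; rewrite subr0.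
rewrite /step.
have := sq 0; rewrite subr0.
under [X in is_derive _ _ X]eq_fun do rewrite subr0.
move=> ?.
have ? := sq (2^-1); have ? := sq 1.
apply: is_derive_eq.
rewrite /hat /GRing.scale /= ; ring.
Qed.

Lemma step_le0 z : z <= 0 -> step z = 0.
Proof.
by move=> z0; rewrite /step /sqpos !max_r; [ring | lra..].
Qed.

Lemma step_ge1 z : 1 <= z -> step z = 1.
Proof.
by move=> z0; rewrite /step /sqpos !max_l; [field | lra..].
Qed.

Lemma step_itv z : 0 <= step z <= 1.
Proof.
rewrite /step /sqpos /Num.max.
case: (ltrP z 0) => ?; case: (ltrP (z - 2^-1) 0) => ?;
  case: (ltrP (z - 1) 0) => ?; apply/andP; split; nra.
Qed.

Lemma hat_itv z : 0 <= hat z <= 2.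
Proof.
rewrite /hat /Num.max.
case: (ltrP z 0) => ?; case: (ltrP (z - 2^-1) 0) => ?;
  case: (ltrP (z - 1) 0) => ?; apply/andP; split; lra.
Qed.

Lemma hat_le0 z : z <= 0 -> hat z = 0.
Proof. by move=> z0; rewrite /hat !max_r; [ring | lra..]. Qed.

Lemma hat_ge1 z : 4^-1 <= z <= 3 / 4 -> 1 <= hat z.
Proof.
move=> /andP[? ?]; rewrite /hat /Num.max.
case: (ltrP z 0) => ?; case: (ltrP (z - 2^-1) 0) => ?;
  case: (ltrP (z - 1) 0) => ?;
  lra.
Qed.

Lemma continuous_hat : continuous hat.
Proof.
have cB c : continuous (fun z : R => z - c).
  by move=> z; apply: cvgB; [exact: cvg_id|exact: cvg_cst].
have cm c : continuous (fun z : R => Num.max (z - c) 0).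
  rewrite (_ : (fun _ => _) = (fun z : R => (z - c + `|z - c|) / 2));
    last first.
    by apply/funext => z; rewrite maxr_absE addr0 subr0.
  move=> z; apply: cvgMl; apply: cvgD; first exact: cB.
  by apply: cvg_norm; exact: cB.
have c0 : continuous (fun z : R => Num.max z 0).
  by have := cm 0; under eq_fun do rewrite subr0.
move=> z; apply: cvgD; [apply: cvgB|]; apply: cvgM; try exact: cvg_cst;
  [exact: c0|exact: cm|exact: cm].
Qed.

(* Rises from 0 to 1 on [[p, p + w]] and falls back to 0 on [[q, q + L]]. *)
Definition plateau p w q L t : R := step ((t - p) / w) - step ((t - q) / L).
Definition dplateau p w q L t : R :=
  w^-1 * hat ((t - p) / w) - L^-1 * hat ((t - q) / L).

Lemma is_derive_plateau p w q L t :
  is_derive t (1 : R) (plateau p w q L) (dplateau p w q L t).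
Proof.
have aux (r k : R) : is_derive t (1 : R) (fun y : R => step ((y - r) / k))
    (k^-1 * hat ((t - r) / k)).
  have := @is_derive1_comp R step (fun y : R => (y - r) / k) t _ _
    (is_derive_step _) _.
  move=> /(_ (k^-1)); rewrite mulrC; apply; apply: is_derive_eq.
  by rewrite /GRing.scale /= ; ring.
have ? := aux p w; have ? := aux q L.
exact: is_derive_eq.
Qed.

Lemma continuous_plateau p w q L : continuous (plateau p w q L).
Proof.
move=> t; apply: differentiable_continuous; apply/derivable1_diffP.
by have [] := is_derive_plateau p w q L t.
Qed.

Lemma continuous_dplateau p w q L : continuous (dplateau p w q L).
Proof.
have aux (r k t : R) :
    {for t, continuous (fun y : R => k^-1 * hat ((y - r) / k))}.
  apply: cvgM; first exact: cvg_cst.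
  apply: (@continuous_comp _ _ _ (fun y : R => (y - r) / k) hat);
    last exact: continuous_hat.
  by apply: cvgM; [apply: cvgB; [exact: cvg_id|exact: cvg_cst]|exact: cvg_cst].
by move=> t; apply: cvgB; exact: aux.
Qed.

Lemma plateau_itv p w q L t :
  0 < w -> 0 < L -> p + w <= q ->
  0 <= plateau p w q L t <= 1.
Proof.
move=> w0 L0 pq.
rewrite /plateau; have [tq|qt] := lerP t q.
  rewrite (@step_le0 ((t - q) / L)) ?subr0 ?step_itv//.
  by rewrite pmulr_lle0 ?invr_gt0// subr_le0.
rewrite (@step_ge1 ((t - p) / w)); last by rewrite ler_pdivlMr//; lra.
by have := step_itv ((t - q) / L); lra.
Qed.

Lemma plateau_out p w q L t :
  0 < w -> 0 < L -> p + w <= q ->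
  ~~ (p < t < q + L) -> plateau p w q L t = 0.
Proof.
move=> w0 L0 pq.
rewrite negb_and -!leNgt /plateau => /orP[tp|qt].
  by rewrite !step_le0 ?subrr// pmulr_lle0 ?invr_gt0//; lra.
by rewrite !step_ge1 ?subrr// ler_pdivlMr//; lra.
Qed.

Lemma plateau1 p w q L t :
  0 < w -> 0 < L -> p + w <= q ->
  p + w <= t <= q -> plateau p w q L t = 1.
Proof.
move=> w0 L0 pq /andP[? ?]; rewrite /plateau step_ge1 ?step_le0 ?subr0//.
  by rewrite pmulr_lle0 ?invr_gt0// subr_le0.
by rewrite ler_pdivlMr//; lra.
Qed.

(** Only the descent contributes negatively, and [hat] is at most 2. *)
Lemma dplateau_ge p w q L t :
  0 < w -> 0 < L -> - (2 / L) <= dplateau p w q L t.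
Proof.
move=> w0 L0.
rewrite /dplateau; have /andP[? _] := hat_itv ((t - p) / w).
have /andP[_ h] := hat_itv ((t - q) / L).
have : 0 <= w^-1 * hat ((t - p) / w) by rewrite mulr_ge0// invr_ge0 ltW.
have : L^-1 * hat ((t - q) / L) <= 2 / L.
  by rewrite mulrC ler_wpM2r// invr_ge0 ltW.
lra.
Qed.

(** In the middle half of the rise [hat] is at least 1, and the descent has not begun. *)
Lemma dplateau_ge1 p w q L t :
  0 < w -> 0 < L -> p + w <= q ->
  p + w / 4 <= t <= p + w * 3 / 4 ->
  w^-1 <= dplateau p w q L t.
Proof.
move=> w0 L0 pq /andP[? ?]; rewrite /dplateau (@hat_le0 ((t - q) / L));
  last first.
  by rewrite pmulr_lle0 ?invr_gt0//; lra.
rewrite mulr0 subr0 ler_peMr ?invr_ge0 ?(ltW w0)//; apply: hat_ge1.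
by rewrite ler_pdivlMr// ler_pdivrMr//; apply/andP; split; lra.
Qed.

Lemma dplateau_norm_le p w q L t :
  0 < w -> 0 < L -> `|dplateau p w q L t| <= 2 / w + 2 / L.
Proof.
move=> w0 L0.
rewrite /dplateau; apply: (le_trans (ler_normB _ _)).
have aux k z : 0 < k -> `|k^-1 * hat z| <= 2 / k.
  move=> k0; have /andP[h0 h2] := hat_itv z.
  rewrite ger0_norm ?mulr_ge0 ?invr_ge0 ?(ltW k0)//.
  by rewrite mulrC ler_wpM2r// invr_ge0 ltW.
by apply: lerD; exact: aux.
Qed.

End profile.

(** * Test fields supported in a strip, and their superposition *)

Section strip_fields.
Context {R : realType}.
Implicit Types (A : set (R * R)) (x y : R * R) (F G f g : R * R -> R).
Implicit Types (b : bool) (u v e : R).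

(** The difference quotients in the plane and on the horizontal line through [x] are the same
    function of the increment. *)
Lemma dx1_partial F x d :
  is_derive x.1 (1 : R) (fun s => F (s, x.2)) d ->
  derivable F x (1, 0)%R /\ dx1 F x = d.
Proof.
have E : (fun h : R => h^-1 *: ((F \o shift x) (h *: ((1, 0) : R * R)) - F x)) =
    (fun h : R => h^-1 *:
      (((fun s => F (s, x.2)) \o shift x.1) (h *: (1 : R)) - F (x.1, x.2))).
  apply/funext => h; rewrite /= -surjective_pairing.
  congr (_ *: (F _ - _)); rewrite [x in LHS]surjective_pairing.
  by congr (_, _); rewrite /= ?scaler0 ?add0r.
move=> [dF <-]; split; first by rewrite /derivable E.
by rewrite /dx1 /derive E.
Qed.

Lemma dx2_partial F x d :
  is_derive x.2 (1 : R) (fun s => F (x.1, s)) d ->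
  derivable F x (0, 1)%R /\ dx2 F x = d.
Proof.
have E : (fun h : R => h^-1 *: ((F \o shift x) (h *: ((0, 1) : R * R)) - F x)) =
    (fun h : R => h^-1 *:
      (((fun s => F (x.1, s)) \o shift x.2) (h *: (1 : R)) - F (x.1, x.2))).
  apply/funext => h; rewrite /= -surjective_pairing.
  congr (_ *: (F _ - _)); rewrite [x in LHS]surjective_pairing.
  by congr (_, _); rewrite /= ?scaler0 ?add0r.
move=> [dF <-]; split; first by rewrite /derivable E.
by rewrite /dx2 /derive E.
Qed.

Lemma continuous_tensor (p q : R -> R) : continuous p -> continuous q ->
  continuous (fun x : R * R => p x.1 * q x.2).
Proof.
move=> cp cq x.
have c1 : {for x, continuous (fun z : R * R => p z.1)}.
  by apply: (@continuous_comp _ _ _ fst p); [exact: cvg_fst|exact: cp].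
have c2 : {for x, continuous (fun z : R * R => q z.2)}.
  by apply: (@continuous_comp _ _ _ snd q); [exact: cvg_snd|exact: cq].
exact: cvgM.
Qed.

Lemma tensor_C1 (p q p' q' : R -> R) :
  (forall t, is_derive t (1 : R) p (p' t)) ->
  (forall t, is_derive t (1 : R) q (q' t)) ->
  continuous p -> continuous q -> continuous p' -> continuous q' ->
  let F := fun x : R * R => p x.1 * q x.2 in
  [/\ Ck 1 F, dx1 F = (fun x => p' x.1 * q x.2) &
      dx2 F = (fun x => p x.1 * q' x.2)].
Proof.
move=> dp dq cp cq cp' cq' F.
have h1 x : derivable F x (1, 0)%R /\ dx1 F x = p' x.1 * q x.2.
  apply: dx1_partial; rewrite /F /=.
  have ? := dp x.1; apply: is_derive_eq.
  by rewrite scaler0 add0r /GRing.scale /= mulrC.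
have h2 x : derivable F x (0, 1)%R /\ dx2 F x = p x.1 * q' x.2.
  apply: dx2_partial; rewrite /F /=.
  by have ? := dq x.2; exact: is_derive_eq.
have e1 : dx1 F = (fun x => p' x.1 * q x.2).
  by apply/funext => x; exact: (h1 x).2.
have e2 : dx2 F = (fun x => p x.1 * q' x.2).
  by apply/funext => x; exact: (h2 x).2.
split => //; split; first exact: continuous_tensor.
split; [by move=> x; exact: (h1 x).1|by move=> x; exact: (h2 x).1|..].
  by rewrite e1; split=> //; exact: continuous_tensor.
by rewrite e2; split=> //; exact: continuous_tensor.
Qed.

Lemma compact_support F (a1 b1 a2 b2 : R) :
  (forall x, F x != 0 -> (a1 <= x.1 <= b1) /\ (a2 <= x.2 <= b2)) ->
  compact (closure [set x | F x != 0]).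
Proof.
move=> supp; pose K : set (R * R) := `[a1, b1] `*` `[a2, b2].
have cK : closed K.
  rewrite (_ : K = (fst @^-1` `[a1, b1]) `&` (snd @^-1` `[a2, b2])) //.
  by apply: closedI; apply: closed_comp => //; try exact: interval_closed;
    move=> x _; [exact: cvg_fst|exact: cvg_snd].
apply: (@subclosed_compact _ _ K); first exact: closed_closure.
  by apply: compact_setX; exact: segment_compact.
rewrite [X in _ `<=` X]((closure_id K).1 cK).
apply: closure_subset => x /= /supp.
by rewrite /K /= !in_itv.
Qed.

Lemma C1cD F G : C1c F -> C1c G -> [/\ C1c (F + G),
  dx1 (F + G) = dx1 F + dx1 G & dx2 (F + G) = dx2 F + dx2 G].
Proof.
move=> [[cF [F1 F2 [cF1 _] [cF2 _]]] sF] [[cG [G1 G2 [cG1 _] [cG2 _]]] sG].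
have e1 : dx1 (F + G) = dx1 F + dx1 G.
  by apply/funext => x; rewrite /dx1 deriveD.
have e2 : dx2 (F + G) = dx2 F + dx2 G.
  by apply/funext => x; rewrite /dx2 deriveD.
split; [|exact: e1|exact: e2]; split; last first.
  apply: (subclosed_compact _ (compactU sF sG)); first exact: closed_closure.
  rewrite -closureU; apply: closure_subset => x /=.
  apply: contraPP => /not_orP[/= /negP/negPn/eqP Fx /negP/negPn/eqP Gx].
  by rewrite fctE Fx Gx addr0 eqxx.
split; first by move=> x; apply: continuousD; [exact: cF|exact: cG].
split; [by move=> x; exact: derivableD|by move=> x; exact: derivableD|..].
  by rewrite e1; split=> // x; apply: continuousD; [exact: cF1|exact: cG1].
by rewrite e2; split=> // x; apply: continuousD; [exact: cF2|exact: cG2].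
Qed.

(* The boolean selects the direction of the strip: [b = false] means that the
   strip is [u < x.1 < v] and that the field is vertical. *)
Definition coord b x : R := if b then x.2 else x.1.
Definition slope b F : R * R -> R := if b then dx1 F else dx2 F.

(** Vanishing off the open strip lets fields on adjacent strips be added; the bound on the slope
    makes the divergence integrable over sets of finite area. *)
Definition strip_field b u v F := [/\ C1c F, forall x, `|F x| <= 1,
  forall x, ~~ (u < coord b x < v) -> F x = 0 &
  exists M, forall x, `|slope b F x| <= M].

(** The factor 1/4 comes from using only the middle half of the strip and the middle half of the
    rise; [e] pays for the descent. *)
Definition strip_bound b A u v := forall e, 0 < e -> exists2 F,
  strip_field b u v F &
  (((v - u) / 4 - e)%:E <= \int[@leb2 R]_(x in A) (slope b F x)%:E)%E.

Lemma slope_continuous b F : C1c F -> continuous (slope b F).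
Proof.
by move=> [[_ [_ _ [c1 _] [c2 _]]] _]; case: b; [exact: c1|exact: c2].
Qed.

Lemma slope_integrable b A F u v : open A -> (@leb2 R A < +oo)%E ->
  strip_field b u v F -> (@leb2 R).-integrable A (EFin \o slope b F).
Proof.
move=> oA fA [C1F _ _ [M hM]].
apply: measurable_bounded_integrable => //; first exact: open_lplane_measurable.
  apply: continuous_lplane_measurable; first exact: open_lplane_measurable.
  exact: slope_continuous.
exists M; split; first exact: num_real.
by move=> M' MM' x _; exact: le_trans (hM x) (ltW MM').
Qed.

(** Completed by a zero component in the other direction, [F] becomes an admissible planar field
    with divergence [slope b F]. *)
Lemma strip_bound_perimeter b A u v : strip_bound b A u v ->
  (((v - u) / 4)%:E <= perimeter (A : set (lplane R)))%E.
Proof.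
move=> H; apply/lee_addgt0Pr => e e0; have [F [C1F F1 _ _] HF] := H e e0.
have C10 : C1c (fun=> 0 : R).
  have [ck _ _] := tensor_C1 (fun t => is_derive_cst (0 : R) t 1)
    (fun t => is_derive_cst (0 : R) t 1)
    (@cst_continuous _ _ _) (@cst_continuous _ _ _)
    (@cst_continuous _ _ _) (@cst_continuous _ _ _).
  split.
    rewrite (_ : (fun=> 0) = (fun x : R * R => 0 * 0 : R)) //.
    by apply/funext => ?; rewrite mul0r.
  by apply: (@compact_support _ 0 0 0 0) => x; rewrite eqxx.
have d10 x : dx1 (fun=> 0 : R) x = 0 by rewrite /dx1 derive_cst.
have d20 x : dx2 (fun=> 0 : R) x = 0 by rewrite /dx2 derive_cst.
have F2 x : F x ^+ 2 <= 1.
  by rewrite -real_normK ?num_real// expr_le1.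
rewrite -leeBlDr// -EFinB; apply: (le_trans HF); apply: ereal_sup_ubound.
case: b {H HF} => /=.
  exists F, (fun=> 0); split => //.
    by move=> x; rewrite expr0n addr0.
  by apply: eq_integral => x _; rewrite d20 addr0.
exists (fun=> 0), F; split => //.
  by move=> x; rewrite expr0n add0r.
by apply: eq_integral => x _; rewrite d10 add0r.
Qed.

(** The two fields are never nonzero at the same point, so their sum is still bounded by 1, while
    the integrals add up. Each field is allowed half of the error. *)
Lemma strip_boundD b A u v w : open A -> (@leb2 R A < +oo)%E ->
  u <= v <= w -> strip_bound b A u v -> strip_bound b A v w ->
  strip_bound b A u w.
Proof.
move=> oA fA /andP[uv vw] H1 H2 e e0.
have e20 : 0 < e / 2 by rewrite divr_gt0.
have [F sF hF] := H1 _ e20; have [G sG hG] := H2 _ e20.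
have iF := slope_integrable oA fA sF; have iG := slope_integrable oA fA sG.
have [C1F F1 F0 [M hM]] := sF; have [C1G G1 G0 [N hN]] := sG.
have [CD D1 D2] := C1cD C1F C1G.
have sD x : slope b (F + G) x = slope b F x + slope b G x.
  by rewrite /slope; case: b {H1 H2 hF hG sF sG F0 G0 iF iG hM hN};
    rewrite ?D1 ?D2.
exists (F + G); first split => //.
(* On the common boundary [v] both fields vanish, so either side of the case split may include
   it. *)
- move=> x; rewrite fctE; have [xv|vx] := leP (coord b x) v.
    by rewrite (G0 x) ?addr0// ltNge xv.
  by rewrite (F0 x) ?add0r// negb_and -!leNgt (ltW vx) orbT.
- move=> x /negP H.
  rewrite fctE F0 ?G0 ?addr0//; apply/negP => /andP[? ?]; apply: H.
    by apply/andP; split => //; exact: le_lt_trans uv _.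
  by apply/andP; split => //; exact: lt_le_trans vw.
- exists (M + N) => x; rewrite sD; apply: (le_trans (ler_normD _ _)).
  exact: lerD.
under eq_integral do rewrite sD EFinD.
rewrite integralD//; last exact: open_lplane_measurable.
apply: le_trans (leeD hF hG); rewrite -EFinD lee_fin; lra.
Qed.

End strip_fields.

(** * Strip bounds for open sets, from rectangles to whole intervals *)

Section strip_local.
Context {R : realType}.
Implicit Types (A : set (R * R)) (x y : R * R) (b : bool) (u v p w e : R).

Lemma strip_tensor b (f f' h h' : R -> R) :
  (forall t, is_derive t (1 : R) f (f' t)) ->
  (forall t, is_derive t (1 : R) h (h' t)) ->
  continuous f -> continuous h -> continuous f' -> continuous h' ->
  let F := fun x => f (coord b x) * h (coord (~~ b) x) in
  Ck 1 F /\ slope b F = (fun x => f (coord b x) * h' (coord (~~ b) x)).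
Proof.
move=> df dh cf ch cf' ch'; case: b => F.
  have [C1 d1 _] := tensor_C1 dh df ch cf ch' cf'.
  have FE : F = (fun x => h x.1 * f x.2) by apply/funext => x; rewrite /F mulrC.
  rewrite FE; split; first exact: C1.
  by rewrite /slope d1; apply/funext => x /=; rewrite mulrC.
by have [C1 _ d2] := tensor_C1 df dh cf ch cf' ch'.
Qed.

Lemma leb2_coord_rectangle b (a1 b1 a2 b2 : R) : a1 <= b1 -> a2 <= b2 ->
  let Q := [set x : R * R | a1 <= coord b x <= b1 /\
                             a2 <= coord (~~ b) x <= b2] in
  measurable (Q : set (lplane R)) /\
  @leb2 R Q = ((b1 - a1) * (b2 - a2))%:E.
Proof.
have len (c d : R) : c <= d ->
    (lebesgue_measure `[c, d]%classic = (d - c)%:E)%E.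
  move=> cd; rewrite lebesgue_measure_itv/= lte_fin; case: ltgtP cd => // -> _.
  by rewrite subrr.
move=> ab1 ab2 Q.
have QE : Q = if b then `[a2, b2]%classic `*` `[a1, b1]%classic
              else `[a1, b1]%classic `*` `[a2, b2]%classic.
  by rewrite /Q; case: b {Q}; apply/seteqP; split => x /=;
    rewrite !in_itv/= => -[].
rewrite QE; case: b {Q QE}; split; try exact: rectangle_measurable;
  rewrite leb2_rectangle// [X in (X * _)%E]len// [X in (_ * X)%E]len//.
by rewrite -EFinM mulrC.
Qed.

Lemma strip_bound_refl b A u : strip_bound b A u u.
Proof.
move=> e e0; pose z := fun _ : R => 0 : R.
have dz t : is_derive t (1 : R) z 0 by exact: is_derive_cst.
have cz : continuous z by exact: cst_continuous.
have [C10 s0] := strip_tensor b dz dz cz cz cz cz.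
exists (fun x => z (coord b x) * z (coord (~~ b) x)).
  split => [|x|x _|]; last (by exists 0 => x; rewrite s0 /z mul0r normr0);
    try by rewrite /z mul0r ?normr0.
  split => //.
  by apply: (@compact_support _ _ 0 0 0 0) => x; rewrite /z mul0r eqxx.
rewrite s0 integral0_eq; last by move=> x _; rewrite /z mul0r.
by rewrite lee_fin subrr mul0r sub0r oppr_le0 ltW.
Qed.

(* The field rises by 1 inside the rectangle and then descends with slope at
   most [2 / L], so the loss is at most [2 |A| / L]. *)
Lemma strip_bound_rectangle b A u v p w : open A -> (@leb2 R A < +oo)%E ->
  u < v -> 0 < w ->
  (forall x, u < coord b x < v -> p < coord (~~ b) x < p + w -> A x) ->
  strip_bound b A u v.
Proof.
move=> oA fA uv w0 sub e e0.
have mA := open_lplane_measurable oA.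
pose m := fine (@leb2 R A).
have mE : @leb2 R A = m%:E by rewrite /m fineK// ge0_fin_numE.
have m0 : 0 <= m by rewrite -lee_fin -mE.
(* The descent costs at most 2 m / L = e m / (m + 1); adding 1 to [m] keeps [L] positive even when
   the area is zero. *)
pose L := 2 * (m + 1) / e.
have L0 : 0 < L by rewrite /L divr_gt0// mulr_gt0// ltr_wpDl.
have Lm : 2 / L * m <= e.
  rewrite /L invf_div mulrA mulrAC ler_pdivrMr;
    last by rewrite mulr_gt0// ltr_wpDl.
  by nra.
(* With transitions of width [k] on both sides, the cut-off [f] equals 1 on the middle half of the
   strip. *)
pose k := (v - u) / 4.
have k0 : 0 < k by rewrite /k divr_gt0// subr_gt0.
have uk : u + k <= v - k by rewrite /k; lra.
have vk : v - k + k = v by rewrite subrK.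
pose f := plateau u k (v - k) k; pose h := plateau p w (p + w) L.
pose h' := dplateau p w (p + w) L.
have fitv t : 0 <= f t <= 1 by exact: plateau_itv.
have hitv t : 0 <= h t <= 1 by apply: plateau_itv.
have h'ge t : - (2 / L) <= h' t by apply: dplateau_ge.
have f0 t : ~~ (u < t < v) -> f t = 0.
  by move=> utv; apply: plateau_out => //; rewrite vk.
have h0 t : ~~ (p < t < p + w + L) -> h t = 0 by exact: plateau_out.
pose F := fun x => f (coord b x) * h (coord (~~ b) x).
have [C1F sF] : Ck 1 F /\
    slope b F = (fun x => f (coord b x) * h' (coord (~~ b) x)).
  exact: (@strip_tensor b f (dplateau u k (v - k) k) h h'
    (is_derive_plateau u k (v - k) k) (is_derive_plateau p w (p + w) L)
    (@continuous_plateau _ u k (v - k) k) (@continuous_plateau _ p w (p + w) L)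
    (@continuous_dplateau _ u k (v - k) k)
    (@continuous_dplateau _ p w (p + w) L)).
have FS : strip_field b u v F.
  split.
  - split => //.
    have supp x : F x != 0 -> (u <= coord b x <= v) /\
        (p <= coord (~~ b) x <= p + w + L).
      move=> Fx; split.
        have : u < coord b x < v.
          by apply: contraNT Fx => /f0 fx; rewrite /F fx mul0r.
        by move=> /andP[/ltW -> /ltW ->].
      have : p < coord (~~ b) x < p + w + L.
        by apply: contraNT Fx => /h0 hx; rewrite /F hx mulr0.
      by move=> /andP[/ltW -> /ltW ->].
    move: supp; rewrite /F; case: (b) => supp.
      by apply: (@compact_support _ _ p (p + w + L) u v) => x /supp[].
    by apply: (@compact_support _ _ u v p (p + w + L)) => x /supp[].
  - move=> x; rewrite /F; have /andP[? ?] := fitv (coord b x).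
    have /andP[? ?] := hitv (coord (~~ b) x).
    by rewrite ger0_norm ?mulr_ge0// mulr_ile1.
  - by move=> x xuv; rewrite /F f0 ?mul0r.
  - exists (2 / w + 2 / L) => x; rewrite sF normrM.
    have /andP[? ?] := fitv (coord b x).
    rewrite -[leRHS]mul1r [`|f _|]ger0_norm// ler_pM//.
    by apply: dplateau_norm_le.
exists F => //.
pose Q := [set x : R * R | u + k <= coord b x <= v - k /\
  p + w / 4 <= coord (~~ b) x <= p + w * 3 / 4].
have [mQ Qleb] : measurable (Q : set (lplane R)) /\ @leb2 R Q =
    ((v - k - (u + k)) * (p + w * 3 / 4 - (p + w / 4)))%:E.
  by apply: leb2_coord_rectangle => //; lra.
have QA : Q `<=` A.
  move=> x [/andP[? ?] /andP[? ?]]; apply: sub; apply/andP; split; lra.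
have bnd (M : R) (g : lplane R -> R) :
    (forall x, `|g x| <= M) -> [bounded g x | x in A].
  move=> gM; exists M; split; first exact: num_real.
  by move=> M' MM' x _; exact: le_trans (gM x) (ltW MM').
have iQ : (@leb2 R).-integrable A (EFin \o \1_Q).
  apply: measurable_bounded_integrable;
    [exact: mA|exact: fA|exact: measurable_indic|].
  by apply: (bnd 1) => x; rewrite indicE; case: (_ \in _);
    rewrite ?normr1 ?normr0.
have i1 := integrableZl mA w^-1 iQ.
have i2 : (@leb2 R).-integrable A (EFin \o cst (2 / L)).
  apply: measurable_bounded_integrable;
    [exact: mA|exact: fA|exact: measurable_cst|].
  by apply: (bnd (2 / L)) => x; rewrite ger0_norm// divr_ge0// ltW.
have i12 := integrableB mA i1 i2.
(* Pointwise comparison: on [Q] one has [f = 1] and the slope of [h] is at least 1/w; everywhere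
   else in [A] the slope of the field is at least -2/L. *)
apply: (@le_trans _ _ (\int[@leb2 R]_(x in A)
    (w^-1%:E * (\1_Q x)%:E - (2 / L)%:E)))%E; last first.
  apply: le_integral; [exact: mA|exact: i12|exact: slope_integrable FS|].
  move=> x _; rewrite -EFinM -EFinB lee_fin sF.
  have /andP[? ?] := fitv (coord b x); have ? := h'ge (coord (~~ b) x).
  have L20 : 0 < 2 / L by rewrite divr_gt0.
  rewrite indicE; case: (boolP (x \in Q)) => [|_] /=.
    rewrite inE => -[xQ1 xQ2]; rewrite [f _]plateau1// mul1r mulr1.
    have : w^-1 <= h' (coord (~~ b) x) by apply: dplateau_ge1.
    by apply: le_trans; rewrite gerBl ltW.
  rewrite mulr0 sub0r; apply: (@le_trans _ _ (f (coord b x) * - (2 / L))).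
    by rewrite mulrN lerN2 ler_piMl// ltW.
  by rewrite ler_wpM2l.
rewrite (integralB mA i1 i2) (integralZl mA iQ).
have -> : (\int[@leb2 R]_(x in A) (EFin \o \1_Q) x)%E = @leb2 R Q.
  by rewrite (integral_indic _ mA mQ) setIidl.
have -> : (\int[@leb2 R]_(x in A) (EFin \o cst (2 / L)%R) x)%E = (2 / L * m)%:E.
  by rewrite EFinM -mE; exact: (integral_cst (@leb2 R) mA (2 / L)%:E).
rewrite Qleb -EFinM -EFinB lee_fin.
(* The area of [Q] is (v - u) / 2 times w / 2. *)
rewrite (_ : w^-1 * _ = (v - u) / 4); first by lra.
by rewrite /k; field; rewrite gt_eqF.
Qed.

(** A continuation argument: the set of endpoints reachable from [a] has a supremum, and a short
    strip around that supremum both attains it and passes beyond it unless it is [c]. *)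
Lemma strip_bound_itv b A (a c : R) : open A -> (@leb2 R A < +oo)%E -> a <= c ->
  (forall t, a <= t <= c -> exists2 x, A x & coord b x = t) ->
  strip_bound b A a c.
Proof.
move=> oA fA ac proj.
(* A square inside [A] around a point with coordinate [t] supplies the rectangle for every short
   strip near [t]. *)
have local t : a <= t <= c -> exists2 e : R, 0 < e &
    forall u v, t - e < u -> u <= v -> v < t + e -> strip_bound b A u v.
  move=> /proj[x Ax <-]; have [e e0 sq] := open_square oA Ax.
  exists e => // u v ? uv ?; move: uv; rewrite le_eqVlt => /predU1P[->|uv].
    exact: strip_bound_refl.
  apply: (@strip_bound_rectangle b A u v (coord (~~ b) x - e) (e + e)) => //.
    by rewrite addr_gt0.
  move=> y /andP[? ?] /andP[? ?]; apply: sq; rewrite /square /=.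
  have : `|coord b y - coord b x| < e.
    by rewrite ltr_distl; apply/andP; split; lra.
  have : `|coord (~~ b) y - coord (~~ b) x| < e.
    by rewrite ltr_distl; apply/andP; split; lra.
  by case: (b).
pose T := [set t | a <= t <= c /\ strip_bound b A a t].
have Ta : T a by split; [rewrite lexx|exact: strip_bound_refl].
have hT : has_sup T by split; [exists a|exists c => t [/andP[]]].
pose s := sup T.
have sa : a <= s by apply: sup_upper_bound.
have sc : s <= c by apply: sup_le_ub; [exists a|move=> t [/andP[]]].
have [|e e0 he] := local s; first by rewrite sa.
have [t [/andP[at_ tc] Tt] st] := sup_adherent e0 hT.
have ts : t <= s by apply: sup_upper_bound => //; split => //; rewrite at_.
(* Half of [e] keeps [w] strictly within reach of the local bound at [s], yet beyond [s] when
   [s < c]. *)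
pose w := Num.min c (s + e / 2).
have tw : t <= w by rewrite le_min tc /=; lra.
have ws : w < s + e by rewrite gt_min; apply/orP; right; lra.
have Tw : T w.
  split; first by rewrite (le_trans at_ tw) ge_min lexx.
  by apply: (strip_boundD oA fA _ Tt); [rewrite at_|exact: he].
have : w <= s by apply: sup_upper_bound.
by rewrite ge_min => /orP[cs|]; [move: Tw.2; rewrite /w min_l//; lra|lra].
Qed.

End strip_local.

(** * Limits superior and inferior against eventual bounds *)

Section limits_ereal.
Context {R : realType}.
Implicit Types (u : nat -> \bar R) (c : \bar R).

Lemma limn_esup_le_near u c :
  (\forall n \near \oo, (u n <= c)%E) -> (limn_esup u <= c)%E.
Proof.
move=> uc; rewrite /limn_esup /limf_esup.
apply: (@le_trans _ _ (ereal_sup (u @` [set n | (u n <= c)%E]))).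
  by apply: ereal_inf_lbound; exists [set n | (u n <= c)%E].
by apply: ge_ereal_sup => _ [n /= + <-].
Qed.

Lemma limn_einf_ge_near u c :
  (\forall n \near \oo, (c <= u n)%E) -> (c <= limn_einf u)%E.
Proof.
move=> cu; rewrite /limn_einf leeNr; apply: limn_esup_le_near.
by near=> n; rewrite leeN2; near: n.
Unshelve. all: by end_near. Qed.

Lemma limn_esup_lt_near u c :
  (limn_esup u < c)%E -> \forall n \near \oo, (u n < c)%E.
Proof.
rewrite /limn_esup /limf_esup => /ereal_inf_lt[_ [V /= FV <-]] supc.
apply: filterS FV => n Vn; apply: le_lt_trans supc.
by apply: ereal_sup_ubound; exists n.
Qed.

End limits_ereal.

(** * The diameter bounds the connected perimeter from below *)

Section connected_perimeter.
Context {R : realType}.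
Implicit Types (A : set (R * R)) (E : set (lplane R)) (x y : R * R).

Lemma continuous_coord b : continuous (coord b : R * R -> R).
Proof. by case: b => x; [exact: cvg_snd|exact: cvg_fst]. Qed.

(** The projection of a connected set is an interval, so every value between the two coordinates is
    attained in [A]. *)
Lemma perimeter_ge_extent b A x y : open A -> connected A ->
  (@leb2 R A < +oo)%E -> A x -> A y ->
  ((`|coord b x - coord b y| / 4)%:E <= perimeter (A : set (lplane R)))%E.
Proof.
move=> oA cA fA; wlog xy : x y / coord b y <= coord b x.
  move=> H Ax Ay; have [|/ltW] := leP (coord b y) (coord b x).
    by move=> ?; exact: H.
  by move=> ?; rewrite distrC; exact: H.
move=> Ax Ay; rewrite ger0_norm ?subr_ge0//.
apply: (@strip_bound_perimeter _ b); apply: strip_bound_itv => // t txy.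
have : connected (coord b @` A).
  apply: connected_continuous_connected => //.
  by apply: continuous_subspaceT => z; exact: continuous_coord.
move=> /connected_intervalP /(_ (coord b y) (coord b x)).
have img z : A z -> (coord b @` A) (coord b z) by exists z.
by move=> /(_ (img y Ay) (img x Ax) t txy)[z Az <-]; exists z.
Qed.

Lemma measurable_L1_integrand (E F : set (lplane R)) :
  measurable E -> measurable F ->
  measurable_fun (setT : set (lplane R))
    (fun x : lplane R => (`|\1_E x - \1_F x|%:E : \bar R)).
Proof.
move=> mE mF; apply/measurable_EFinP.
apply: measurableT_comp; first exact: normr_measurable.
by apply: measurable_funB; exact: measurable_indic.
Qed.

(** The hypothesis says that [B] lies in the symmetric difference, whose measure is the L^1
    distance. *)
Lemma leb2_le_L1 (B E F : set (lplane R)) : measurable B -> measurable E ->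
  measurable F -> (forall x, B x -> `|\1_E x - \1_F x| = 1 :> R) ->
  (@leb2 R B <= \int[@leb2 R]_x `|\1_E x - \1_F x|%:E)%E.
Proof.
move=> mB mE mF BEF.
have <- : (\int[@leb2 R]_x (\1_B x)%:E = @leb2 R B)%E.
  by rewrite (integral_indic _ measurableT mB) setIT.
apply: ge0_le_integral; [exact: measurableT|by move=> x _; rewrite lee_fin| |
  exact: measurable_L1_integrand|].
- by apply/measurable_EFinP; exact: measurable_indic.
- move=> x _; rewrite lee_fin indicE; case: (boolP (x \in B)) => [|_].
    by rewrite inE => /BEF ->.
  by rewrite normr_ge0.
Qed.

(** The support of Lebesgue measure restricted to [E]; [ess_diam] is the supremum of distances
    between such points. *)
Definition ess_point E x := forall r, 0 < r -> (0 < @leb2 R (E `&` disk x r))%E.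

Lemma cvg_L1_near (A : nat -> set (R * R)) E e : cvg_L1 A E -> (0 < e)%E ->
  \forall n \near \oo, (\int[@leb2 R]_x `|\1_(A n) x - \1_E x|%:E < e)%E.
Proof.
move=> AE e0; exact: AE _ (open_ereal_lt' e0).
Qed.

(** Once the L^1 distance is below 1, [A n] exceeds [E] by area at most 1. This supplies the finite
    area that the perimeter bound asks for. *)
Lemma cvg_L1_finite (A : nat -> set (R * R)) E : measurable E ->
  (@leb2 R E < +oo)%E -> (forall n, open (A n)) -> cvg_L1 A E ->
  \forall n \near \oo, (@leb2 R (A n) < +oo)%E.
Proof.
move=> mE fE oA AE; have := cvg_L1_near AE lte01; apply: filterS => n An.
have mA : measurable (A n : set (lplane R)) by exact: open_lplane_measurable.
have mD : measurable (A n `\` E : set (lplane R)) by exact: measurableD.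
apply: (@le_lt_trans _ _ (@leb2 R E + @leb2 R (A n `\` E))%E).
  apply: le_trans (measureU2 _ mE mD); apply: le_measure; rewrite ?inE//.
    exact: measurableU.
  by move=> x Ax; have [Ex|nEx] := pselect (E x); [left|right].
apply: lte_add_pinfty => //; apply: (le_lt_trans _ (lt_trans An (ltry 1))).
apply: leb2_le_L1 => // x [Ax nEx].
by rewrite !indicE mem_set// memNset// subr0 normr1.
Qed.

(** Missing the disk would keep the L^1 distance above the positive measure of [E] in that disk. *)
Lemma cvg_L1_meets (A : nat -> set (R * R)) E x r : measurable E ->
  (forall n, open (A n)) -> cvg_L1 A E -> ess_point E x -> 0 < r ->
  \forall n \near \oo, A n `&` disk x r !=set0.
Proof.
move=> mE oA AE xE r0; have := cvg_L1_near AE (xE r r0); apply: filterS => n An.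
apply/set0P/negP => /eqP An0; move: An; apply/negP; rewrite -leNgt.
have mA : measurable (A n : set (lplane R)) by exact: open_lplane_measurable.
apply: leb2_le_L1 => //.
  by apply: measurableI => //; exact: disk_measurable.
move=> y [Ey xy]; rewrite !indicE memNset; last first.
  by move=> Ay; have : (A n `&` disk x r) y by []; rewrite An0.
by rewrite mem_set// sub0r normrN normr1.
Qed.

Lemma connected_perimeter_ge_dist E x y : measurable E ->
  (@leb2 R E < +oo)%E -> ess_point E x -> ess_point E y ->
  ((dist2 x y / 8)%:E <= connected_perimeter E)%E.
Proof.
move=> mE fE xE yE; apply: le_ereal_inf_tmp => _ [A [cA sA AE ->]].
have oA n : open (A n) by exact: (sA n).1.
apply/lee_addgt0Pr => e e0; rewrite -leeBlDr// -EFinB.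
apply: limn_einf_ge_near; near=> n.
have fA : (@leb2 R (A n) < +oo)%E by near: n; exact: cvg_L1_finite.
have [x' [Ax' xx']] : A n `&` disk x e !=set0 by near: n; exact: cvg_L1_meets.
have [y' [Ay' yy']] : A n `&` disk y e !=set0 by near: n; exact: cvg_L1_meets.
(* One coordinate carries at least half of the distance; with the factor 1/4 of the strip bound this
   gives 1/8. Moving both points by less than [e] costs at most 2 e / 4. *)
have [b hb] : exists b, dist2 x y / 2 <= `|coord b x - coord b y|.
  have := dist2_le_coord x y.
  have [h|h] := leP (dist2 x y / 2) `|x.1 - y.1|; first by exists false.
  by exists true; rewrite /=; lra.
apply: le_trans (perimeter_ge_extent b (oA n) (cA n) fA Ax' Ay').
have near_coord z z' : disk z e z' -> `|coord b z - coord b z'| < e.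
  have [h1 h2] := dist2_coord z z'; rewrite /disk /=; apply: le_lt_trans.
  by case: (b).
have h1 := near_coord _ _ xx'; have h2 := near_coord _ _ yy'.
have : `|coord b x - coord b y| <= `|coord b x - coord b x'| +
    `|coord b x' - coord b y'| + `|coord b y - coord b y'|.
  rewrite (_ : coord b x - coord b y = (coord b x - coord b x') +
    (coord b x' - coord b y') - (coord b y - coord b y')); last by ring.
  by apply: (le_trans (ler_normB _ _)); rewrite lerD2r; exact: ler_normD.
rewrite lee_fin; lra.
Unshelve. all: by end_near. Qed.

Lemma connected_perimeter_ge_diam E : measurable E -> (@leb2 R E < +oo)%E ->
  (8^-1%:E * ess_diam E <= connected_perimeter E)%E.
Proof.
move=> mE fE; rewrite muleC -lee_pdivlMr// ?invr_gt0//.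
apply: ge_ereal_sup => _ [x [y [xE yE ->]]].
rewrite lee_pdivlMr// -EFinM; exact: connected_perimeter_ge_dist.
Qed.

End connected_perimeter.

(** * Lower bounds for integrals and for the logarithmic energy *)

Import HBNNSimple.

(* The integral of the negative part is a supremum over simple functions, each
   of them a.e. at most [c]; hence [f] may be non-measurable. *)
Lemma integral_ge_ae (R : realType) d (T : measurableType d)
    (mu : {measure set T -> \bar R})
    (D : set T) (f : T -> \bar R) (c : R) :
  measurable D -> (mu D < +oo)%E -> 0 <= c ->
  {ae mu, forall x, D x -> ((- c)%:E <= f x)%E} ->
  (- (c%:E * mu D) <= \int[mu]_(x in D) f x)%E.
Proof.
move=> mD fD c0 fc.
have neg : (\int[mu]_(x in D) f^\- x <= c%:E * mu D)%E.
  rewrite ge0_integralE//.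
  apply: ge_ereal_sup => _ [h /= hf <-].
  rewrite -integral_cst//.
  (* [h] is nonnegative and lies below a function that is zero off [D], so it vanishes there. *)
  have -> : sintegral mu h = (\int[mu]_(x in D) (h x)%:E)%E.
    rewrite integral_nnsfun//; congr sintegral; apply/funext => x.
    rewrite patchE; case: ifPn => // xD; apply/eqP.
    have := hf x; rewrite patchE (negbTE xD) lee_fin eq_le => ->.
    by rewrite fun_ge0.
  apply: ae_ge0_le_integral;
    [exact: mD|by move=> x _; rewrite lee_fin fun_ge0| | | |].
  - apply/measurable_EFinP; exact: measurable_funTS.
  - by move=> x _; rewrite lee_fin.
  - exact: measurable_cst.
  - apply: filterS fc => x fx Dx; apply: le_trans (hf x) _.
    rewrite patchE mem_set// funenegE ge_max lee_fin c0 andbT.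
    by rewrite leeNl -EFinN; exact: fx.
have pos : (0 <= \int[mu]_(x in D) f^\+ x)%E.
  by apply: integral_ge0 => x _; exact: funepos_ge0.
rewrite integralE -[leLHS]add0e; apply: leeD => //.
by rewrite leeN2.
Qed.

Section energy.
Context {R : realType}.
Implicit Types (E : set (lplane R)) (x y : R * R).

(** A point of [E] that is not essential lies in some rational square meeting [E] in a null set;
    countably many such null pieces cover all exceptions. *)
Lemma ess_point_ae E : measurable E ->
  {ae @leb2 R, forall x, E x -> ess_point E x}.
Proof.
move=> mE.
pose bad n := if unpickle n is Some p then
   if (@leb2 R (E `&` rational_square p) == 0)%E then E `&` rational_square p
   else set0 else set0.
apply: (@negligibleS _ _ _ _ (\bigcup_n bad n)); last first.
  apply: negligible_bigcup => n; rewrite /bad.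
  case: (unpickle n) => [p|]; last exact: negligible_set0.
  case: ifPn => [/eqP p0|_]; last exact: negligible_set0.
  apply/negligibleP => //; apply: measurableI => //; exact: square_measurable.
move=> x /= /not_implyP[Ex].
move=> /existsNP[r /not_implyP[r0 /negP]]; rewrite -leNgt => Er.
have r20 : 0 < r / 2 by rewrite divr_gt0.
have [p [px psub]] := rational_square_approx x r20.
exists (pickle p); first exact: I.
rewrite /bad pickleK; case: ifPn => [_|/negP[]]; first exact: (conj Ex px).
rewrite eq_le measure_ge0 andbT; apply: le_trans Er.
apply: le_measure; rewrite ?inE.
- by apply: measurableI => //; exact: square_measurable.
- by apply: measurableI => //; exact: disk_measurable.
- by apply: setIS => y /psub; exact: square_sub_disk.
Qed.

(** The almost everywhere bound is used twice: with constant [l] for the inner integral, then with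
    [a * l] for the outer one. *)
Lemma log_energy_ge E (a l : R) : measurable E -> @leb2 R E = a%:E -> 0 <= l ->
  (forall x y, ess_point E x -> ess_point E y -> ln (dist2 x y) <= l) ->
  ((- (a ^+ 2 * l))%:E <= log_energy E)%E.
Proof.
move=> mE aE l0 dl.
have a0 : 0 <= a by rewrite -lee_fin -aE measure_ge0.
have fE : (@leb2 R E < +oo)%E by rewrite aE ltry.
have -> : ((- (a ^+ 2 * l))%:E = - ((a * l)%:E * @leb2 R E))%E.
  by rewrite aE -EFinM -EFinN; congr (- _)%:E; ring.
apply: integral_ge_ae; [exact: mE|exact: fE|exact: mulr_ge0|].
apply: (negligibleS _ (ess_point_ae mE)); apply: subsetC => x Px Ex.
have -> : ((- (a * l))%:E = - (l%:E * @leb2 R E))%E.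
  by rewrite aE -EFinM -EFinN mulrC.
apply: integral_ge_ae; [exact: mE|exact: fE|exact: l0|].
apply: (negligibleS _ (ess_point_ae mE)); apply: subsetC => y Py Ey.
(* On the diagonal the conventions for the inverse and [ln] at 0 make the kernel 0, which is still
   at least [- l]. *)
rewrite lee_fin; have [d0|d0] := leP (dist2 x y) 0.
  by rewrite ln0 ?oppr_le0// invr_le0.
by rewrite lnV ?posrE// lerN2; apply: dl; [exact: Px|exact: Py].
Qed.

(** Positive measure provides an essential point; without one the supremum would be that of the
    empty set, [-oo]. *)
Lemma ess_diam_ge0 E : measurable E -> (0 < @leb2 R E)%E -> (0 <= ess_diam E)%E.
Proof.
move=> mE E0; have [[x xE]|/forallNP noE] := pselect (exists x, ess_point E x).
  apply: le_trans (ereal_sup_ubound _);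
    last by exists x, x; split; [exact: xE|exact: xE|].
  by rewrite lee_fin dist2_ge0.
suff : @leb2 R E = 0%E by move=> E00; rewrite E00 ltxx in E0.
apply: measure_negligible => //.
apply: negligibleS (ess_point_ae mE) => x Ex /=.
by move=> /(_ Ex); exact: noE.
Qed.

Lemma functionalF_ge E (lam a : R) : 0 < lam -> 0 < a -> measurable E ->
  @leb2 R E = a%:E -> (functionalF lam E < +oo)%E ->
  exists D : R, [/\ 0 <= D, ess_diam E = D%:E &
   ((8^-1 * D - lam * (a ^+ 2 * Num.max (ln D) 0))%:E <= functionalF lam E)%E].
Proof.
move=> lam0 a0 mE aE; rewrite /functionalF.
have fE : (@leb2 R E < +oo)%E by rewrite aE ltry.
have D0 : (0 <= ess_diam E)%E by apply: ess_diam_ge0 => //; rewrite aE.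
case: ifPn => // PE _; have := connected_perimeter_ge_diam mE fE.
case DE : (ess_diam E) D0 => [D| |] // D0; last first.
  (* An infinite diameter would force an infinite connected perimeter, excluded by the finiteness of
     the functional. *)
  by rewrite gt0_muley ?lte_fin ?invr_gt0// leye_eq (negbTE PE).
rewrite lee_fin in D0; move=> PD; exists D; split => //.
rewrite EFinB; apply: leeD; first by rewrite EFinM.
rewrite -EFinN -mulrN EFinM lee_pmul2l ?lte_fin//.
apply: log_energy_ge => //; first by rewrite le_max lexx orbT.
move=> x y xE yE; rewrite le_max.
have [d0|d0] := leP (dist2 x y) 0; first by rewrite ln0 ?lexx ?orbT.
have dD : dist2 x y <= D.
  rewrite -lee_fin -DE; apply: ereal_sup_ubound; exists x, y.
  by split; [exact: xE|exact: yE|].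
by rewrite ler_ln ?posrE ?dD// (lt_le_trans d0).
Qed.

End energy.

(** * Comparison of growth rates as [lambda] tends to infinity *)

Section asymptotics.
Context {R : realType}.

(** Used with l = log lambda and t = log D. The inequality gives exp(t - l) <= 8 (a^2 + 1) t, while
    t - l is at least the fraction d / (1 + d) of [t]; exponential growth then bounds [t], hence
    [l]. *)
Lemma expR_growth (a d l t : R) : 0 < d -> 0 < l -> (1 + d) * l < t ->
  expR t / 8 - expR l * (a ^+ 2 * t) <= expR l * l ->
  l <= 32 * (a ^+ 2 + 1) * ((1 + d) / d) ^+ 2.
Proof.
move=> d0 l0 lt H.
have d10 : 0 < 1 + d by rewrite ltr_wpDl.
pose c := d / (1 + d); have c0 : 0 < c by rewrite divr_gt0.
have lt' : l < t by nra.
have t0 : 0 < t by exact: lt_trans lt'.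
have ctl : c * t <= t - l.
  have : l <= t / (1 + d) by rewrite ler_pdivlMr// mulrC ltW.
  have : t / (1 + d) = t - c * t by rewrite /c; field; rewrite gt_eqF.
  lra.
have a2 : 0 <= a ^+ 2 by exact: sqr_ge0.
have H1 : expR (t - l) <= 8 * ((a ^+ 2 + 1) * t).
  rewrite expRD expRN ler_pdivrMr ?expR_gt0//.
  have := expR_gt0 l; nra.
have H2 : (c * t) ^+ 2 / 4 <= expR (t - l).
  apply: (@le_trans _ _ (expR (c * t))); last by rewrite ler_expR.
  (* Squaring exp(x) >= 1 + x at half the argument yields quadratic growth, enough to beat the
     linear right-hand side. *)
  rewrite (_ : c * t = c * t / 2 + c * t / 2); last by field.
  rewrite expRD; have := expR_ge1Dx (c * t / 2).
  have : 0 < c * t / 2 by rewrite divr_gt0// mulr_gt0.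
  nra.
have H3 : c ^+ 2 * t <= 32 * (a ^+ 2 + 1).
  rewrite -(ler_pM2r t0); move: (le_trans H2 H1); rewrite exprMn; nra.
apply: (le_trans (ltW lt')).
rewrite -[(1 + d) / d]invf_div -/c exprVn ler_pdivlMr ?exprn_gt0//.
by rewrite mulrC.
Qed.

Lemma cvg_squeeze_ereal (u : nat -> \bar R) :
  (forall e, 0 < e -> e < 1 ->
    \forall n \near \oo, ((1 - e)%:E <= u n <= (1 + e)%:E)%E) ->
  (u n @[n --> \oo] --> 1)%E.
Proof.
move=> H.
have half : 0 < 2^-1 :> R by [].
apply/fine_cvgP; split.
  have := H _ half (ltac:(lra)); apply: filterS => n /andP[h1 h2].
  by rewrite fin_numElt (lt_le_trans _ h1) ?ltNyr// (le_lt_trans h2) ?ltry.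
apply/cvgrPdist_le => e e0.
(* The hypothesis speaks only of errors below 1. *)
have e20 : 0 < Num.min e 2^-1 by rewrite lt_min e0.
have e21 : Num.min e 2^-1 < 1 by rewrite gt_min; apply/orP; right; lra.
have := H _ e20 e21; apply: filterS => n /andP[] /=.
have : Num.min e 2^-1 <= e by rewrite ge_min lexx.
case: (u n) => [r| |] // me; rewrite !lee_fin /= => h1 h2.
by rewrite ler_norml; apply/andP; split; lra.
Qed.

Section families.
Variables (lambda : nat -> R) (E : nat -> set (lplane R)).
Hypotheses (lambda_gt0 : forall n, 0 < lambda n)
  (lambda_cvg : lambda n @[n --> \oo] --> +oo)
  (mE : forall n, measurable (E n))
  (areaE : forall n, @leb2 R (E n) = (pi : R)%:E).

Let F n := functionalF (lambda n) (E n).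

Lemma near_ln_lambda (c : R) : \forall n \near \oo, c < ln (lambda n).
Proof.
near=> n; rewrite -ltr_expR lnK ?posrE//; near: n.
by move/cvgryPgt : lambda_cvg; apply.
Unshelve. all: by end_near. Qed.

Lemma near_diam_upper (d : R) : 0 < d ->
  (limn_esup (fun n => F n * ((lambda n * ln (lambda n))^-1)%:E) <= 0)%E ->
  \forall n \near \oo,
    (lne (ess_diam (E n)) * ((ln (lambda n))^-1)%:E <= (1 + d)%:E)%E.
Proof.
move=> d0 F0.
(* The strict bound 1 holds eventually for the quotient itself: the functional is below
   [lambda n * ln (lambda n)]. *)
have F1 : (limn_esup (fun n => F n * ((lambda n * ln (lambda n))^-1)%:E) < 1)%E.
  by apply: le_lt_trans F0 _; exact: lte01.
(* The second entry is the bound of [expR_growth], to be contradicted; the entry 0 makes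
   [ln (lambda n)] positive. *)
pose C := Num.max 0 (32 * (pi ^+ 2 + 1) * ((1 + d) / d) ^+ 2 : R).
near=> n.
have : C < ln (lambda n) by near: n; exact: near_ln_lambda.
rewrite gt_max => /andP[l0 Cl].
have lam0 := lambda_gt0 n.
have Fn : (F n * ((lambda n * ln (lambda n))^-1)%:E < 1)%E.
  by near: n; exact: limn_esup_lt_near.
rewrite lte_pdivrMr ?mulr_gt0// mul1e in Fn.
have [D [D0 DE DF]] : exists D : R, [/\ 0 <= D, ess_diam (E n) = D%:E &
   ((8^-1 * D - lambda n * (pi ^+ 2 * Num.max (ln D) 0))%:E <= F n)%E].
  apply: functionalF_ge; [exact: lam0|exact: pi_gt0|exact: mE|exact: areaE|].
  exact: lt_trans Fn (ltry _).
rewrite lee_pdivrMr// DE -EFinM.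
move: D0; rewrite le_eqVlt => /predU1P[<-|D0].
  by rewrite le0_lneNy// leNye.
rewrite lne_EFin// lee_fin leNgt; apply/negP => lD.
have lD0 : 0 < ln D by apply: lt_trans lD; rewrite mulr_gt0// ltr_wpDl.
move: (le_lt_trans DF Fn); rewrite lte_fin max_l ?ltW// => H.
move: Cl; apply/negP; rewrite -leNgt.
apply: (@expR_growth _ _ _ (ln D)) => //.
by rewrite !lnK ?posrE// mulrC ltW.
Unshelve. all: by end_near. Qed.

(** Discarding the nonnegative term D / 8 and dividing by pi^2 lambda turns the energy bound into a
    lower bound for log D. *)
Lemma near_diam_lower (e : R) : 0 < e -> e < 1 ->
  (limn_esup (fun n => F n * ((lambda n * ln (lambda n))^-1)%:E)
    = (- pi ^+ 2)%:E)%E ->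
  \forall n \near \oo,
    ((1 - e)%:E <= lne (ess_diam (E n)) * ((ln (lambda n))^-1)%:E)%E.
Proof.
move=> e0 e1 FE.
have p20 : 0 < (pi : R) ^+ 2 by rewrite exprn_gt0// pi_gt0.
have F1 : (limn_esup (fun n => F n * ((lambda n * ln (lambda n))^-1)%:E)
    < (- (pi ^+ 2 * (1 - e)))%:E)%E.
  by rewrite FE lte_fin; nra.
near=> n.
have l0 : 0 < ln (lambda n) by near: n; exact: near_ln_lambda.
have lam0 := lambda_gt0 n.
have Fn : (F n * ((lambda n * ln (lambda n))^-1)%:E <
    (- (pi ^+ 2 * (1 - e)))%:E)%E.
  by near: n; exact: limn_esup_lt_near.
rewrite lte_pdivrMr ?mulr_gt0// -EFinM in Fn.
have [D [D0 DE DF]] : exists D : R, [/\ 0 <= D, ess_diam (E n) = D%:E &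
   ((8^-1 * D - lambda n * (pi ^+ 2 * Num.max (ln D) 0))%:E <= F n)%E].
  apply: functionalF_ge; [exact: lam0|exact: pi_gt0|exact: mE|exact: areaE|].
  exact: lt_trans Fn (ltry _).
rewrite lee_pdivlMr// DE -EFinM.
move: (le_lt_trans DF Fn); rewrite lte_fin => H.
have {}H : (1 - e) * ln (lambda n) < Num.max (ln D) 0.
  have k0 : 0 < lambda n * pi ^+ 2 by rewrite mulr_gt0.
  rewrite -(ltr_pM2l k0); lra.
(* The left side is nonnegative, so the maximum cannot be 0. *)
have {}H : (1 - e) * ln (lambda n) < ln D.
  move: H; rewrite lt_max => /orP[//|]; rewrite ltNge mulr_ge0 ?(ltW l0)//.
  by rewrite subr_ge0 ltW.
(* At D = 0 the real logarithm is 0 by convention, against the strict inequality just obtained. *)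
have D1 : 0 < D.
  rewrite lt_neqAle D0 andbT eq_sym; apply/eqP => D00.
  move: H; rewrite D00 [ln 0]ln0// ltNge mulr_ge0 ?(ltW l0)//.
  by rewrite subr_ge0 ltW.
by rewrite lne_EFin// lee_fin ltW.
Unshelve. all: by end_near. Qed.

End families.
End asymptotics.

Unset Implicit Arguments.
Local Open Scope ereal_scope.

Theorem theorem3p10 (R : realType) (lambda : nat -> R)
    (E : nat -> set (lplane R))
    (lambda_gt0 : forall n, (0 < lambda n)%R)
    (lambda_cvg : lambda n @[n --> \oo] --> +oo%R)
    (mE : forall n, measurable (E n))
    (areaE : forall n, @leb2 R (E n) = (pi : R)%:E) :
  (limn_esup (fun n => functionalF (lambda n) (E n) *
       ((lambda n * ln (lambda n))^-1)%:E) <= 0 ->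
   limn_esup (fun n => lne (ess_diam (E n)) * ((ln (lambda n))^-1)%:E) <= 1)
  /\
  (limn_esup (fun n => functionalF (lambda n) (E n) *
       ((lambda n * ln (lambda n))^-1)%:E) = (- ((pi : R) ^+ 2))%:E ->
   lne (ess_diam (E n)) * ((ln (lambda n))^-1)%:E @[n --> \oo] --> 1).
Proof.
split => [F0|FE].
  apply/lee_addgt0Pr => d d0; apply: limn_esup_le_near.
  exact: (near_diam_upper lambda_gt0 lambda_cvg mE areaE d0 F0).
(* The limit value in (2) is nonpositive, so the upper bound from (1) applies as well. *)
have F0 : limn_esup (fun n => functionalF (lambda n) (E n) *
    ((lambda n * ln (lambda n))^-1)%:E) <= 0.
  by rewrite FE lee_fin oppr_le0 sqr_ge0.
apply: cvg_squeeze_ereal => e e0 e1; near=> n; apply/andP; split; near: n.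
  exact: (near_diam_lower lambda_gt0 lambda_cvg mE areaE e0 e1 FE).
exact: (near_diam_upper lambda_gt0 lambda_cvg mE areaE e0 F0).
Unshelve. all: by end_near. Qed.
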